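(* Let $\Gamma=(V,E)$ be a finite point-transitive reflexive relation, let $v\in V$, put $r=|\Gamma(v)|$, and let $j\ge 1$ be an integer. Assume $\Gamma^j(v)\cap\Gamma^{-}(v)=\{v\}$. Then $$|\Gamma^{j}(v)\setminus\Gamma^{j-1}(v)|\ge r-1.$$
   Context: A relation is a pair $\Gamma=(V,E)$ with $E\subset V\times V$; it is reflexive if $(x,x)\in E$ for all $x\in V$. For $a\in V$, $\Gamma(a)=\{y:(a,y)\in E\}$. The reverse relation is $\Gamma^-=(V,E^-)$ with $E^-=\{(x,y):(y,x)\in E\}$, so $\Gamma^-(v)=\{x:(x,v)\in E\}$. $\Gamma^k$ denotes the $k$-fold composition of $\Gamma$ with itself ($\Gamma^0$ is the identity relation), so $\Gamma^k(a)$ is the set of vertices reachable from $a$ by a walk of exactly $k$ arcs. An automorphism of $\Gamma$ is a bijection $f:V\to V$ with $(x,y)\in E\iff(f(x),f(y))\in E$; $\Gamma$ is point-transitive if the automorphism group acts transitively on $V$. *)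

(* Defs.v *)
From mathcomp Require Import all_boot.
Set Implicit Arguments.
Unset Strict Implicit.
Unset Printing Implicit Defensive.

Section Relations.
Variable V : finType.
Implicit Types E F : rel V.

Definition rel_rev E : rel V := [rel x y | E y x].

Definition rel_comp E F : rel V := [rel x z | [exists y, E x y && F y z]].

Definition rel_pow E (k : nat) : rel V := iter k (rel_comp E) [rel x y | x == y].

Definition rel_image E (a : V) : {set V} := [set y | E a y].

Definition rel_automorphism E (f : V -> V) : Prop :=
  bijective f /\ forall x y, E x y <-> E (f x) (f y).

Definition point_transitive E : Prop :=
  forall x y, exists f : V -> V, rel_automorphism E f /\ f x = y.

End Relations.

(* Main.v *)
(** Let [n = #|V|].  For [j >= 2], the pair [X = Γ^(j-1)(v) \ v], [Z = V \ Γ^j(v)] has no arc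
    from [X] to [Z], avoids [v], and contains the out- and in-neighbours of [v]
    respectively; it suffices to show [#|X| + #|Z| + r <= n] for such pairs, a
    condition invariant under reversing all arcs.

    Among the pairs of nonempty sets with no arc from the first to the second,
    take [(A, B)] maximising [#|A| + #|B|], then minimising the smaller of the
    two sizes; up to reversal this is [#|A|], and up to an automorphism [v] lies
    in [A].  Since [(A :&: X, B :|: Z)] and [(A :|: X, B :&: Z)] are again such
    pairs, [A] is a block of imprimitivity.  If the inequality failed, then
    [n - #|A| - #|B| < r - 1 <= #|Z|]; as [V \ (A :|: B)] is empty or at least as
    large as [A], uncrossing [(v |: X, Z)] with [(A, B)] replaces the former by
    [(A :&: (v |: X), B :|: Z)] without decreasing the total size.  Induction on
    the point-transitive relation induced on [A] bounds the part inside [A], and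
    the out-neighbours of [v] outside [A] bound the rest. *)
Require Import Defs.
From mathcomp Require Import all_boot all_fingroup zify.

Set Implicit Arguments.
Unset Strict Implicit.
Unset Printing Implicit Defensive.

Section Separation.
Local Open Scope group_scope.
Local Open Scope nat_scope.

Variable V : finType.
Implicit Types (E F : rel V) (A B X Z W : {set V}) (G : {group {perm V}}).

(** * Pairs of sets joined by no arc, inside an ambient set *)

Definition no_arc E X Z := [forall x in X, forall z in Z, ~~ E x z].

(** [W] acts as the vertex set, so that the induction can pass to a subset without changing the type
    [V]. *)
Definition separated E W X Z :=
  [&& X \subset W, Z \subset W, X != set0, Z != set0 & no_arc E X Z].

Definition preserves E G := forall g x y, g \in G -> E (g x) (g y) = E x y.

Definition homogeneous G W :=
  (forall g x, g \in G -> (g x \in W) = (x \in W)) /\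
  (forall x y, x \in W -> y \in W -> exists2 g : {perm V}, g \in G & g x = y).

(** Taking [(X, Z)] to be [(A, B)] itself gives [#|A| <= #|B|]. *)
Definition optimal E W A B :=
  separated E W A B /\
  forall X Z, separated E W X Z ->
    #|X| + #|Z| <= #|A| + #|B| /\
    (#|X| + #|Z| = #|A| + #|B| -> #|A| <= #|X| /\ #|A| <= #|Z|).

Lemma no_arcP E X Z :
  reflect (forall x z, x \in X -> z \in Z -> ~~ E x z) (no_arc E X Z).
Proof.
apply: (iffP forall_inP) => [H x z xX zZ|H x xX].
  by move/forall_inP: (H x xX); apply.
by apply/forall_inP => z zZ; apply: H.
Qed.

Lemma separatedP E W X Z :
  reflect [/\ X \subset W, Z \subset W, X != set0, Z != set0
            & forall x z, x \in X -> z \in Z -> ~~ E x z]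
          (separated E W X Z).
Proof. by apply: (iffP and5P) => -[? ? ? ? /no_arcP]. Qed.

Lemma separated_rev E W X Z :
  separated (rel_rev E) W Z X = separated E W X Z.
Proof.
by apply/separatedP/separatedP => -[? ? ? ? H]; split=> // x z xX zZ;
  apply: H.
Qed.

Lemma separatedIU E W A B X Z :
  separated E W A B -> separated E W X Z -> A :&: X != set0 ->
  separated E W (A :&: X) (B :|: Z).
Proof.
move=> /separatedP[AW BW _ Bn AB] /separatedP[XW ZW _ _ XZ] n0.
apply/separatedP; split=> //.
- by apply: subset_trans AW; apply: subsetIl.
- by rewrite subUset BW ZW.
- by apply: contraNneq Bn => U0; rewrite -subset0 -U0 subsetUl.
by move=> x z /setIP[xA xX] /setUP[zB|zZ]; [apply: AB | apply: XZ].
Qed.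

Lemma separatedUI E W A B X Z :
  separated E W A B -> separated E W X Z -> B :&: Z != set0 ->
  separated E W (A :|: X) (B :&: Z).
Proof.
by rewrite -!(separated_rev E) => sAB sXZ n0; apply: separatedIU.
Qed.

Lemma separated_disjoint E W X Z :
  reflexive E -> separated E W X Z -> [disjoint X & Z].
Proof.
move=> Erefl /separatedP[_ _ _ _ XZ]; rewrite disjoints_subset.
by apply/subsetP => x xX; rewrite inE; apply/negP => /(XZ _ _ xX); rewrite Erefl.
Qed.

Lemma preserves_rev E G : preserves E G -> preserves (rel_rev E) G.
Proof. by move=> pE g x y gG; apply: pE. Qed.

Lemma separated_imset E W G A B (g : {perm V}) :
  preserves E G -> homogeneous G W -> g \in G ->
  separated E W A B -> separated E W (g @: A) (g @: B).
Proof.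
move=> pE [GW _] gG /separatedP[AW BW An Bn AB].
have imW (C : {set V}) : C \subset W -> g @: C \subset W.
  by move=> /subsetP CW; apply/subsetP=> _ /imsetP[x xC ->]; rewrite GW ?CW.
apply/separatedP; split; rewrite ?imW ?imset_eq0 //.
by move=> _ _ /imsetP[x xA ->] /imsetP[z zB ->]; rewrite (pE _ _ _ gG) AB.
Qed.

(** * Optimal pairs and blocks of imprimitivity *)

Lemma optimal_imset E W G A B (g : {perm V}) :
  preserves E G -> homogeneous G W -> g \in G ->
  optimal E W A B -> optimal E W (g @: A) (g @: B).
Proof.
move=> pE hG gG [sAB opt]; split; first exact: separated_imset hG gG sAB.
by move=> X Z; rewrite !(card_imset _ (@perm_inj _ g)); apply: opt.
Qed.

Lemma optimal_block E W G A B (g : {perm V}) :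
  preserves E G -> homogeneous G W -> optimal E W A B -> g \in G ->
  A :&: g @: A != set0 -> g @: A = A.
Proof.
move=> pE hG [sAB opt] gG n0.
have sg := separated_imset pE hG gG sAB.
have s1 := separatedIU sAB sg n0.
have [le1 min1] := opt _ _ s1.
have [_ /(_ erefl)[_ leAB]] := opt _ _ sAB.
have cA : #|g @: A| = #|A| by rewrite card_imset //; apply: perm_inj.
have cB : #|g @: B| = #|B| by rewrite card_imset //; apply: perm_inj.
have UA := cardsUI A (g @: A); have UB := cardsUI B (g @: B).
have pos : 0 < #|A :&: g @: A| by rewrite card_gt0.
(* If [B] and its image are disjoint, their union has 2|B| >= |A| + |B| points; with the nonempty
   [A :&: g @: A] this exceeds the maximum. Otherwise the two uncrossed totals add up to twice the
   maximum, so both attain it. *)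
have [B0|Bn] := eqVneq (B :&: g @: B) set0.
  by move: UB; rewrite B0 cards0; lia.
have [le2 _] := opt _ _ (separatedUI sAB sg Bn).
have [leA _] := min1 ltac:(lia).
have /eqP IA : A :&: g @: A == A by rewrite eqEcard subsetIl.
by apply/esym/eqP; rewrite eqEcard cA leqnn andbT -{1}IA subsetIr.
Qed.

Lemma exists_optimal E W X Z :
  separated E W X Z ->
  exists A B, optimal E W A B \/ optimal (rel_rev E) W A B.
Proof.
have [N cle] : exists N, forall C : {set V}, #|C| <= N.
  by exists #|V| => C; apply: max_card.
move=> sXZ.
(* A lexicographic weight: the second term is at most [N], so the total size dominates and the
   smaller part breaks ties. *)
pose M (p : {set V} * {set V}) :=
  (#|p.1| + #|p.2|) * N.+1 + (N - minn #|p.1| #|p.2|).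
case: (@arg_maxnP _ (X, Z) (fun p => separated E W p.1 p.2) M sXZ).
move=> [A B] /= sAB opt.
have best (F F' : {set V}) : separated E W F F' ->
    #|F| + #|F'| <= #|A| + #|B| /\
    (#|F| + #|F'| = #|A| + #|B| ->
     minn #|A| #|B| <= #|F| /\ minn #|A| #|B| <= #|F'|).
  move=> sF; have := opt (F, F') sF; rewrite /M /= => leM.
  move: (cle B) (cle F') (cle A) (cle F) => leB leF' leA leF.
  split=> [|eqs]; last by move: leM; rewrite eqs leq_add2l; lia.
  rewrite leqNgt; apply/negP => lts.
  have := leq_mul lts (leqnn N.+1); move: leM; rewrite mulSn; lia.
have [leAB|/ltnW leBA] := leqP #|A| #|B|.
  exists A, B; left; split=> // F F' /best [].
  by move: leAB => /minn_idPl ->.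
exists B, A; right; split; first by rewrite separated_rev.
move=> F F'; rewrite separated_rev => /best [].
move: leBA => /minn_idPr ->; rewrite addnC (addnC #|B|) => ? H.
by split=> // /H[].
Qed.

(** * Orbits and stabilisers *)

Lemma card_stab_homogeneous G W x :
  homogeneous G W -> x \in W -> #|W| * #|'C_G[x | 'P]| = #|G|.
Proof.
move=> [GW trG] xW; rewrite -(card_orbit_stab 'P G x); congr (#|pred_of_set _| * _).
apply/setP => y; apply/idP/orbitP => [yW|[g gG <-]].
  by have [g gG <-] := trG x y xW yW; exists g.
by rewrite /= /aperm GW.
Qed.

(* The stabiliser of [A] is transitive on [A] and contains the stabilisers of
   the points of [A], which have the same order as those of any point of [W]. *)
Lemma leq_card_orbit_block G W A v y (S := 'N_G(A | 'P)%G) :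
  homogeneous G W -> A \subset W -> v \in A -> y \in W ->
  homogeneous S A -> 'C_G[v | 'P] \subset S -> #|A| <= #|orbit 'P S y|.
Proof.
move=> hG /subsetP AW vA yW hS vS.
have sSG : S \subset G by apply: subsetIl.
have cA := card_stab_homogeneous hS vA.
have cO := card_orbit_stab 'P S y.
have cv := card_stab_homogeneous hG (AW _ vA).
have cy := card_stab_homogeneous hG yW.
have W0 : 0 < #|W| by rewrite card_gt0; apply/set0Pn; exists y.
have eqc : #|'C_G[v | 'P]| = #|'C_G[y | 'P]|.
  by apply/eqP; rewrite -(eqn_pmul2l W0) cv cy.
have le1 : #|'C_S[y | 'P]| <= #|'C_G[y | 'P]| by apply/subset_leq_card/setSI.
have le2 : #|'C_G[v | 'P]| <= #|'C_S[v | 'P]|.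
  by apply: subset_leq_card; rewrite subsetI vS subsetIr.
have pos : 0 < #|'C_S[v | 'P]| by apply: cardG_gt0.
rewrite -(leq_pmul2r pos) cA -cO leq_mul2l (leq_trans le1) ?orbT //.
by rewrite -eqc.
Qed.

(** An element of [G] sending one point of [A] into [A] makes [A] meet its image, hence stabilises
    the block [A]. *)
Lemma homogeneous_block E G W A B v :
  preserves E G -> homogeneous G W -> optimal E W A B -> v \in A ->
  homogeneous 'N_G(A | 'P)%G A /\ 'C_G[v | 'P] \subset 'N_G(A | 'P).
Proof.
move=> pE hG opt vA.
have AW : A \subset W by case: opt => /separatedP[].
have stab g x : g \in G -> x \in A -> g x \in A -> g \in 'N_G(A | 'P).
  move=> gG xA gxA; rewrite inE gG /=.
  have gA : g @: A = A.
    apply: optimal_block pE hG opt gG _; apply/set0Pn; exists (g x).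
    by rewrite inE gxA imset_f.
  rewrite !inE /=; apply/subsetP=> z zA; rewrite inE /= /aperm.
  by rewrite -gA imset_f.
split; last first.
  apply/subsetP=> g /setIP[gG /astab1P]; rewrite /= /aperm => gv.
  by apply: (stab g v); rewrite // gv.
split=> [g x|x y xA yA].
  by move=> /setIP[_ gN]; apply: (astabs_act x gN).
have [g gG gxy] := hG.2 x y (subsetP AW _ xA) (subsetP AW _ yA).
by exists g => //; apply: (stab g x); rewrite // gxy.
Qed.

(** * Degrees inside an invariant set *)

Definition out_in E W v := [set y in W | E v y].

Lemma card_out_in_act E G W x y :
  preserves E G -> homogeneous G W -> x \in W -> y \in W ->
  #|out_in E W x| = #|out_in E W y|.
Proof.
move=> pE [GW trG] xW yW; have [g gG <-] := trG x y xW yW.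
rewrite -(card_imset _ (@perm_inj _ g)); congr #|pred_of_set _|.
apply/setP=> z; rewrite -[z](permKV g) (mem_imset _ _ (@perm_inj _ g)).
by move: (g^-1 z)%g => t; rewrite !inE GW // pE.
Qed.

(** Counting the arcs inside [W] by tail and by head gives |W| times the out-degree and |W| times
    the in-degree. *)
Lemma card_out_in_rev E G W v :
  preserves E G -> homogeneous G W -> v \in W ->
  #|out_in (rel_rev E) W v| = #|out_in E W v|.
Proof.
move=> pE hG vW.
have W0 : 0 < #|W| by rewrite card_gt0; apply/set0Pn; exists v.
have cardE F x : #|out_in F W x| = \sum_(y in W) F x y.
  rewrite -sum1_card big_mkcond /= [RHS]big_mkcond /=.
  by apply: eq_bigr => y _; rewrite inE; case: (y \in W); case: (F x y).
have total F : preserves F G ->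
    \sum_(x in W) \sum_(y in W) F x y = #|W| * #|out_in F W v|.
  move=> pF; rewrite -sum_nat_const; apply: eq_bigr => x xW.
  by rewrite -cardE; apply: card_out_in_act pF hG xW vW.
apply/eqP; rewrite -(eqn_pmul2l W0) -!total //; last exact: preserves_rev.
by rewrite exchange_big.
Qed.

(** * Cuts around a vertex *)

Definition local_cut E W v X Z :=
  [/\ [/\ X \subset W, Z \subset W, v \notin X & v \notin Z],
      out_in E W v :\ v \subset X, out_in (rel_rev E) W v :\ v \subset Z
    & forall x z, x \in X -> z \in Z -> ~~ E x z].

Lemma local_cut_rev E W v X Z :
  local_cut E W v X Z -> local_cut (rel_rev E) W v Z X.
Proof. by move=> [[? ? ? ?] ? ? H]; split=> // z x zZ xX; apply: H. Qed.

Lemma local_cut_restrict E W v X Z A :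
  A \subset W -> local_cut E W v X Z -> local_cut E A v (X :&: A) (Z :&: A).
Proof.
move=> /subsetP AW [[XW ZW vX vZ] /subsetP oX /subsetP oZ XZ].
split; first by rewrite !subsetIr !inE (negbTE vX) (negbTE vZ).
- apply/subsetP=> y; rewrite !inE => /and3P[yv yA vy].
  by rewrite yA andbT oX // !inE yv AW.
- apply/subsetP=> y; rewrite !inE => /and3P[yv yA vy].
  by rewrite yA andbT oZ // !inE yv AW.
by move=> x z /setIP[xX _] /setIP[zZ _]; apply: XZ.
Qed.

(** An arc from [v] to a point of [Z] would put that point in [X], where its loop is an arc from [X]
    to [Z]. *)
Lemma local_cut_separated E W v X Z :
  reflexive E -> v \in W -> local_cut E W v X Z -> Z != set0 ->
  separated E W (v |: X) Z.
Proof.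
move=> Erefl vW [[XW ZW vX vZ] /subsetP oX _ XZ] Zn.
apply/separatedP; split=> //.
- by rewrite subUset sub1set vW.
- by apply/set0Pn; exists v; rewrite setU11.
move=> x z /setU1P[->|xX] zZ; last exact: XZ.
apply/negP => vz; suff /XZ/(_ zZ) : z \in X by rewrite Erefl.
apply: oX; rewrite !inE vz (subsetP ZW) // !andbT.
by apply: contraNneq vZ => <-.
Qed.

(** The orbit of an outside point [y] under the stabiliser of [A] has at least |A| points. It avoids
    [A], and it avoids [B] because [y] has an in-neighbour in [A]. *)
Lemma optimal_boundary E G W A B v :
  reflexive E -> preserves E G -> homogeneous G W -> optimal E W A B ->
  v \in A -> W :\: (A :|: B) != set0 -> #|A| <= #|W :\: (A :|: B)|.
Proof.
move=> Erefl pE hG opt vA /set0Pn[y]; rewrite !inE negb_or => /andP[/andP[yA yB] yW].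
have [hS vS] := homogeneous_block pE hG opt vA.
have [/separatedP[AW BW An Bn AB] best] := opt.
apply: leq_trans (leq_card_orbit_block hG AW vA yW hS vS) _.
(* Otherwise [y] could be added to [B], against maximality. *)
have [a aA Eay] : exists2 a, a \in A & E a y.
  apply/exists_inP; apply: contraT; rewrite negb_exists_in => /forall_inP noE.
  have /best[] : separated E W A (y |: B).
    apply/separatedP; split=> //; first by rewrite subUset sub1set yW.
      by apply/set0Pn; exists y; rewrite setU11.
    by move=> x z xA /setU1P[->|zB]; [apply: noE | apply: AB].
  by rewrite cardsU1 yB; lia.
apply/subset_leq_card/subsetP=> _ /orbitP[g gS <-]; rewrite /= /aperm.
have gG : g \in G by case/setIP: gS.
rewrite !inE hG.1 // yW hS.1 // (negbTE yA) andbT /=.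
by apply/negP => /(AB (g a)); rewrite hS.1 // pE // Eay => /(_ aA).
Qed.

Lemma local_cut_uncross E G W A B v X Z :
  reflexive E -> preserves E G -> homogeneous G W -> optimal E W A B ->
  v \in A -> local_cut E W v X Z -> Z != set0 ->
  #|W| < #|X| + #|Z| + #|out_in E W v| ->
  #|v |: X| + #|Z| <= #|A :&: (v |: X)| + #|B :|: Z|.
Proof.
move=> Erefl pE hG opt vA cut Zn big.
have [sAB best] := opt; have [AW BW An Bn AB] := separatedP _ _ _ _ sAB.
have vW := subsetP AW _ vA.
have sXZ := local_cut_separated Erefl vW cut Zn.
have [[XW ZW vX vZ] oX oZ XZ] := cut.
have n0 : A :&: (v |: X) != set0.
  by apply/set0Pn; exists v; rewrite inE vA setU11.
have [leI _] := best _ _ (separatedIU sAB sXZ n0).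
have UA := cardsUI A (v |: X); have UB := cardsUI B Z.
(* If [B] meets [Z], the second uncrossed pair is at most the maximum, so the first keeps at least
   the total of [(v |: X, Z)]. *)
have [B0|Bn0] := eqVneq (B :&: Z) set0; last first.
  have [leU _] := best _ _ (separatedUI sAB sXZ Bn0).
  by clear - UA UB leU; lia.
have [leX _] := best _ _ sXZ.
move: leX UB leI; rewrite B0 cards0 cardsU1 vX /= => leX UB leI.
have dAB := separated_disjoint Erefl sAB.
have cAB : #|A :|: B| = #|A| + #|B|.
  by rewrite cardsU; move: dAB; rewrite -setI_eq0 => /eqP ->; rewrite cards0 subn0.
have cR : #|W :\: (A :|: B)| + (#|A| + #|B|) = #|W|.
  rewrite -cAB -(cardsID (A :|: B) W) addnC; congr (_ + _).
  by rewrite (setIidPr _) // subUset AW.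
have dZ : #|out_in E W v| <= #|Z|.+1.
  rewrite -(card_out_in_rev pE hG vW) (cardsD1 v).
  exact: leq_add (leq_b1 _) (subset_leq_card oZ).
(* A nonempty rest R gives |A| <= |R| < r - 1 <= |Z| with r the out-degree of [v] in [W], while
   [leI] forces |Z| < |A|. *)
have [R0|Rn] := eqVneq (W :\: (A :|: B)) set0; last first.
  have leAR := optimal_boundary Erefl pE hG opt vA Rn.
  have I0 : 0 < #|A :&: (v |: X)| by rewrite card_gt0.
  by clear - leAR I0 big UB leI cR dZ leX; lia.
suff : #|(v |: X) :\: A| <= #|B|.
  have := cardsID A (v |: X); rewrite setIC cardsU1 vX.
  by clear - UB; lia.
apply/subset_leq_card/subsetP=> x /setDP[xX xA].
have xW : x \in W.
  by case/setU1P: xX => [->//|]; apply: (subsetP XW).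
move/setP/(_ x): R0; rewrite !inE xW (negbTE xA) /= andbT.
by move/negbFE.
Qed.

Lemma local_cut_step E G W A B v X Z :
  reflexive E -> preserves E G -> homogeneous G W -> optimal E W A B ->
  v \in A -> local_cut E W v X Z -> Z != set0 ->
  #|X :&: A| + #|Z :&: A| + #|out_in E A v| <= #|A| ->
  #|X| + #|Z| + #|out_in E W v| <= #|W|.
Proof.
move=> Erefl pE hG opt vA cut Zn IH; rewrite leqNgt; apply/negP => big.
have unc := local_cut_uncross Erefl pE hG opt vA cut Zn big.
have [sAB _] := opt; have [AW BW An Bn AB] := separatedP _ _ _ _ sAB.
have vW := subsetP AW _ vA.
have [_ _ _ _ vXZ] := separatedP _ _ _ _ (local_cut_separated Erefl vW cut Zn).
have [[XW ZW vX vZ] oX oZ XZ] := cut.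
have cI : #|A :&: (v |: X)| = (#|X :&: A|).+1.
  rewrite (cardsD1 v) inE vA setU11 add1n; congr (_.+1); apply: eq_card => x.
  rewrite !inE; case: eqVneq => [->|_] /=; first by rewrite (negbTE vX).
  by rewrite andbC.
have cU : #|B :|: Z| = #|Z :&: A| + #|(B :|: Z) :\: A|.
  rewrite -(cardsID A (B :|: Z)) setIUl; congr (#|pred_of_set _| + _).
  have := separated_disjoint Erefl sAB; rewrite disjoint_sym -setI_eq0 => /eqP ->.
  by rewrite set0U.
have cO : #|out_in E W v| = #|out_in E A v| + #|out_in E W v :\: A|.
  rewrite -(cardsID A (out_in E W v)); congr (_ + _); apply: eq_card => x.
  by rewrite !inE; case: (boolP (x \in A)) => [/(subsetP AW) ->|]; rewrite ?andbF ?andbT.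
have cW : #|W| = #|A| + #|W :\: A|.
  by rewrite -(cardsID A W) (setIidPr AW).
(* No arc leads from [v], a point of both [A] and [v |: X], into [B] or [Z]. This count outside [A]
   complements [IH] inside [A]. *)
have : #|(B :|: Z) :\: A| + #|out_in E W v :\: A| <= #|W :\: A|.
  have := cardsUI ((B :|: Z) :\: A) (out_in E W v :\: A).
  have -> : ((B :|: Z) :\: A) :&: (out_in E W v :\: A) = set0.
    apply/setP=> x; rewrite !inE; apply/negP.
    move=> /andP[/andP[_ /orP[xB|xZ]] /and3P[_ _ vx]].
      by move: (AB _ _ vA xB); rewrite vx.
    by move: (vXZ v x (setU11 _ _) xZ); rewrite vx.
  rewrite cards0 addn0 => <-; apply/subset_leq_card.
  rewrite -setDUl; apply: setSD; rewrite !subUset BW ZW /=.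
  by apply/subsetP=> x; rewrite inE => /andP[].
by move: unc IH big; rewrite cI cU cardsU1 vX cW cO; clear; lia.
Qed.

(** Induction on |W|, passing to the block [A] with its setwise stabiliser; [A] is proper since [B]
    is nonempty and, by reflexivity, disjoint from it. *)
Lemma local_cut_bound E G W v X Z :
  reflexive E -> preserves E G -> homogeneous G W -> v \in W ->
  local_cut E W v X Z -> #|X| + #|Z| + #|out_in E W v| <= #|W|.
Proof.
have [n] := ubnP #|W|; elim: n E G W v X Z => // n IHn E G W v X Z ltWn.
move=> Erefl pE hG vW cut.
have [Z0|Zn] := eqVneq Z set0.
  have [[XW _ vX _] _ oZ _] := cut.
  have : #|out_in E W v| <= 1.
    rewrite -(card_out_in_rev pE hG vW) (cardsD1 v).
    move: oZ; rewrite Z0 subset0 => /eqP ->; rewrite cards0.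
    by case: (v \in _).
  have : #|v |: X| <= #|W| by apply/subset_leq_card; rewrite subUset sub1set vW.
  by rewrite Z0 cards0 cardsU1 vX; clear; lia.
(* The relation is left free so that the step serves both [E] and its reverse, according to which
   has the optimal pair. *)
have step F A B X' Z' : reflexive F -> preserves F G -> optimal F W A B ->
    local_cut F W v X' Z' -> Z' != set0 ->
    #|X'| + #|Z'| + #|out_in F W v| <= #|W|.
  move=> Frefl pF opt0 cut' Zn'.
  have [/separatedP[AW0 _ /set0Pn[a aA] _ _] _] := opt0.
  have [g gG gav] := hG.2 a v (subsetP AW0 _ aA) vW.
  have opt := optimal_imset pF hG gG opt0.
  have vA : v \in g @: A by rewrite -gav imset_f.
  have [hS _] := homogeneous_block pF hG opt vA.
  have [sAB _] := opt; have [AW BW An Bn AB] := separatedP _ _ _ _ sAB.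
  apply: (local_cut_step Frefl pF hG opt vA cut' Zn').
  apply: IHn hS vA _ => //; last exact: local_cut_restrict cut'.
    rewrite -ltnS; apply: leq_trans ltWn; rewrite ltnS; apply: proper_card; rewrite properE AW /=.
    apply/subsetPn; case/set0Pn: Bn => b bB; exists b; first exact: (subsetP BW).
    by apply/negP => /AB/(_ bB); rewrite Frefl.
  by move=> h x y /setIP[hG' _]; apply: pF.
have [A [B [opt|opt]]] := exists_optimal (local_cut_separated Erefl vW cut Zn).
  exact: step opt cut Zn.
(* After reversal [X] becomes the second set, so its emptiness is a separate case: then [v] has no
   out-neighbour in [W] besides itself. *)
have [X0|Xn] := eqVneq X set0; last first.
  rewrite -(card_out_in_rev pE hG vW) (addnC #|X|).
  exact: (step (rel_rev E) _ _ _ _ Erefl (preserves_rev pE) opt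
            (local_cut_rev cut)).
have [[_ ZW _ vZ] oX _ _] := cut.
have : #|out_in E W v| <= 1.
  rewrite (cardsD1 v); move: oX; rewrite X0 subset0 => /eqP ->.
  by rewrite cards0; case: (v \in _).
have : #|v |: Z| <= #|W| by apply/subset_leq_card; rewrite subUset sub1set vW.
by rewrite X0 cards0 cardsU1 vZ; clear; lia.
Qed.

(** * The automorphism group *)

Definition aut_set E : {set {perm V}} :=
  [set g : {perm V} | [forall x, forall y, E (g x) (g y) == E x y]].

Lemma aut_setP E (g : {perm V}) :
  reflect (forall x y, E (g x) (g y) = E x y) (g \in aut_set E).
Proof.
rewrite inE; apply: (iffP forallP) => [H x y|H x].
  by move/forallP: (H x) => /(_ y)/eqP.
by apply/forallP => y; rewrite H.
Qed.

Lemma aut_set_group E : group_set (aut_set E).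
Proof.
apply/group_setP; split; first by apply/aut_setP=> x y; rewrite !perm1.
move=> g h /aut_setP gE /aut_setP hE; apply/aut_setP=> x y.
by rewrite !permM hE gE.
Qed.

Canonical aut_group E := Group (aut_set_group E).

Lemma preserves_aut_group E : preserves E (aut_group E).
Proof. by move=> g x y /aut_setP. Qed.

Lemma homogeneous_aut_group E :
  point_transitive E -> homogeneous (aut_group E) setT.
Proof.
move=> trE; split=> [g x _|x y _ _]; first by rewrite !inE.
have [f [[bf fE] fx]] := trE x y.
exists (perm (bij_inj bf)); last by rewrite permE.
by apply/aut_setP=> z t; rewrite !permE; apply/idP/idP => /(fE z t).
Qed.

(** * Powers of the relation and the final count *)

Lemma rel_pow_refl E k x : reflexive E -> rel_pow E k x x.
Proof.
by move=> Erefl; elim: k => //= k IH; apply/existsP; exists x; rewrite Erefl.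
Qed.

Lemma rel_powSr E k x y z : rel_pow E k x y -> E y z -> rel_pow E k.+1 x z.
Proof.
elim: k x => [|k IH] x /=.
  by move=> /eqP -> yz; apply/existsP; exists z; rewrite yz /=.
move=> /existsP[t /andP[xt ty]] yz; apply/existsP; exists t; rewrite xt.
exact: IH ty yz.
Qed.

End Separation.

Theorem theorem4p2 (V : finType) (E : rel V) (v : V) (r j : nat)
    (E_refl : reflexive E)
    (E_ptrans : point_transitive E)
    (r_def : r = #|rel_image E v|)
    (j_ge1 : 1 <= j)
    (E_cap : rel_image (rel_pow E j) v :&: rel_image (rel_rev E) v = [set v]) :
  r - 1 <= #|rel_image (rel_pow E j) v :\: rel_image (rel_pow E (j - 1)) v|.
Proof.
have outE : out_in E setT v = rel_image E v by apply/setP=> y; rewrite !inE.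
case: j j_ge1 E_cap => [//|[|k]] _ E_cap; rewrite !subn1 succnK.
  (* For j = 1 the set removed is {v}, and the r - 1 other out-neighbours of [v] remain. *)
  rewrite r_def (cardsD1 v) inE E_refl add1n /=.
  apply/subset_leq_card/subsetP=> y; rewrite !inE eq_sym => /andP[-> vy] /=.
  by apply/existsP; exists y; rewrite vy /=.
set P1 := rel_image (rel_pow E k.+1) v.
set P2 := rel_image (rel_pow E k.+2) v in E_cap *.
have vP1 : v \in P1 by rewrite inE; apply: rel_pow_refl.
have vP2 : v \in P2 by rewrite inE; apply: rel_pow_refl.
(* Since j - 1 >= 1, [P1] contains the out-neighbours of [v]; [E_cap] keeps the in-neighbours other
   than [v] out of [P2]; an arc leaving [P1] ends in [P2]. *)
have cut : local_cut E setT v (P1 :\ v) (~: P2).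
  split; first by rewrite !subsetT setD11 in_setC negbK vP2.
  - apply/subsetP=> y; rewrite !inE => /andP[-> vy] /=.
    by apply/existsP; exists y; rewrite [E v y]vy; apply: rel_pow_refl.
  - apply/subsetP=> y /setD1P[yv yE]; rewrite inE; apply: contra yv => yP2.
    by rewrite -in_set1 -E_cap inE yP2; move: yE; rewrite !inE.
  move=> x z /setD1P[_ xP1]; rewrite inE; apply: contra => xz.
  by rewrite inE in xP1; rewrite inE; apply: rel_powSr xP1 xz.
(* The bound reads (|P1| - 1) + (n - |P2|) + r <= n with n = |V|, that is |P2| - |P1| >= r - 1. *)
have := local_cut_bound E_refl (@preserves_aut_group _ E)
  (homogeneous_aut_group E_ptrans) (in_setT v) cut.
rewrite outE -r_def cardsT; have := cardsC P2; have := cardsD1 v P1.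
have := cardsID P1 P2; have : #|P2 :&: P1| <= #|P1|.
  by apply/subset_leq_card/subsetIr.
by rewrite vP1; clear; lia.
Qed.
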